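(* Let $\mathcal{X}$ be a curve of genus $g$ over $\mathbb{F}_q$, let $Q,P_1,\dots,P_n$ be distinct rational points of $\mathcal{X}$ with $n>2g+2$, and let $D=P_1+\dots+P_n$. If the sequence of codes $(C(D,m_iQ))_{i=0,\dots,n}$ satisfies the isometry-dual condition, then for every $i=1,\dots,n$, $$d_{ORD,ev}(C(D,m_iQ))=d^*(i).$$
   Context: ''Curve'' means projective, non-singular, geometrically irreducible algebraic curve. For a divisor $E$, $\mathcal{L}(E)$ is its Riemann–Roch space. Let $v=-v_Q$, where $v_Q$ is the valuation at $Q$, and $\mathcal{L}(\infty Q)=\bigcup_{r\ge 0}\mathcal{L}(rQ)$. The evaluation map is $ev:\mathcal{L}(\infty Q)\to\mathbb{F}_q^n$, $ev(f)=(f(P_1),\dots,f(P_n))$, and $C(D,mQ)=ev(\mathcal{L}(mQ))$ (so $C(D,-Q)=(0)$). The Weierstrass semigroup is $H=H(Q)=\{v(f): f\in\mathcal{L}(\infty Q)\setminus\{0\}\}$. Let $H^*=\{m\in\mathbb{N}_0 : C(D,mQ)\neq C(D,(m-1)Q)\}$; it has exactly $n$ elements, written $m_1<m_2<\dots<m_n$. Put $m_0=-1$, so $C(D,m_0Q)=(0)$. Isometry-dual condition: for $\mathbf{x}\in(\mathbb{F}_q^* )^n$ (all coordinates non-zero) let $\chi_{\mathbf{x}}:\mathbb{F}_q^n\to\mathbb{F}_q^n$, $\chi_{\mathbf{x}}(\mathbf{v})=(x_1v_1,\dots,x_nv_n)$. A sequence of codes $(C_i)_{i=0,\dots,n}$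 in $\mathbb{F}_q^n$ (with $C_0\subset C_1\subset\dots\subset C_n$, $\dim C_i=i$) satisfies the isometry-dual condition if there is $\mathbf{x}\in(\mathbb{F}_q^* )^n$ with $\chi_{\mathbf{x}}(C_i)=C_{n-i}^\perp$ for all $i=0,\dots,n$. The bound $d^*$: $\Lambda_i^*=\{m\in H^* : m=m_i+m_j \text{ for some } m_j\in H^*\}$ (equivalently $(m_i+H)\cap H^*$), and $d^*(i)=\min\{\#\Lambda_r^* : 1\le r\le i\}$. The strict order bound: for $h\in H$ let $A[h]=\{t\in H : h-t\in H\}$; under the isometry-dual condition the strict order bound (with respect to $ev$) of $C(D,m_iQ)$ is $$d_{ORD,ev}(C(D,m_iQ))=\min\{\#A[h] : h\in H^*,\ h\ge n+2g-1-m_i\}.$$ *)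

(* Defs.v *)
From HB Require Import structures.
From mathcomp Require Import all_boot all_order all_algebra.
From mathcomp Require Import finmap.
From mathcomp Require Import boolp classical_sets cardinality.
From mathcomp Require Import freeg.
Import Order.TTheory GRing.Theory Num.Theory.

Set Implicit Arguments.
Unset Strict Implicit.
Unset Printing Implicit Defensive.

Local Open Scope ring_scope.
Local Open Scope classical_set_scope.

(* A projective, non-singular, geometrically irreducible curve over k is given,
   as an abstract non-singular complete curve, by its function field: a field
   of transcendence degree one, finitely generated over k, in which k is
   algebraically closed.  As k is perfect, the last condition is geometric
   irreducibility.  The closed points of the curve are the places below. *)
Record curve (k : finFieldType) := Curve {
  ffield : fieldType;
  cst : {rmorphism k -> ffield};
  curve_fun_field : exists2 x : ffield, ~ algebraicOver cst x &
    exists (d : nat) (b : 'I_d -> ffield), forall f : ffield,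
      exists (p : 'I_d -> {poly k}) (q : {poly k}), q != 0 /\
        f = \sum_i (map_poly cst (p i)).[x] / (map_poly cst q).[x] * b i;
  curve_full_cst : forall f : ffield, algebraicOver cst f ->
    exists c : k, f = cst c
}.
Arguments cst {k c}.

(* A point is a normalized discrete valuation of the function field, trivial
   on k, i.e. the order of vanishing at that point.  Its value at 0 should be
   +oo; it is fixed to be 0, so that a point is determined by its valuation on
   nonzero functions, and [ord_ge] below treats f = 0 separately. *)
Record point (k : finFieldType) (X : curve k) := Point {
  ord :> ffield X -> int;
  ord0 : ord 0 = 0;
  ord_cst : forall c : k, ord (cst c) = 0;
  ordM : forall f h, f != 0 -> h != 0 -> ord (f * h) = ord f + ord h;
  ordD : forall f h, f != 0 -> h != 0 -> f + h != 0 ->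
    Num.min (ord f) (ord h) <= ord (f + h);
  ord_normalized : exists t, ord t = 1
}.

HB.instance Definition _ (k : finFieldType) (X : curve k) :=
  gen_eqMixin (point X).
HB.instance Definition _ (k : finFieldType) (X : curve k) :=
  gen_choiceMixin (point X).

Section Curve.
Variables (k : finFieldType) (X : curve k).
Implicit Types (P Q : point X) (f : ffield X).

Definition ord_ge P f (z : int) : Prop := f = 0 \/ z <= P f.

(* dim_k (U / W) = d, for k-subspaces W of U of the function field. *)
Definition is_dim (U W : set (ffield X)) (d : nat) : Prop :=
  exists b : 'I_d -> ffield X, (forall i, U (b i)) /\
    forall u, U u -> exists! c : 'rV[k]_d, W (u - \sum_i cst (c 0 i) * b i).

(* As usual for a total dimension function, this is 0 if the dimension is
   infinite (which happens neither for residue fields nor for the spaces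
   L(A)). *)
Definition dimq (U W : set (ffield X)) : nat := xget 0%N [set d | is_dim U W d].

(* The degree of P is the degree over k of its residue field O_P / M_P. *)
Definition pdeg P : nat := dimq [set f | ord_ge P f 0] [set f | ord_ge P f 1].

Definition rational P : Prop := pdeg P = 1%N.

Definition divisor := {freeg (point X) / int}.

Definition ddeg (A : divisor) : int := fglift (fun P => (pdeg P)%:Z : int^o) A.

Definition RR (A : divisor) : set (ffield X) :=
  [set f | forall P, ord_ge P f (- coeff P A)].

Definition ell (A : divisor) : nat := dimq (RR A) [set 0].

(* g = max { deg A - ell A + 1 : A a divisor } *)
Definition has_genus (g : nat) : Prop :=
  (forall A : divisor, ddeg A - (ell A)%:Z + 1 <= g%:Z) /\
  (exists A : divisor, ddeg A - (ell A)%:Z + 1 = g%:Z).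

Definition RRinf Q : set (ffield X) :=
  \bigcup_(r in [set: nat]) RR << r%:Z *g Q >>.

(* The value f(P) of f, regular at the rational point P: the constant c such
   that f - c vanishes at P. *)
Definition eval P f : k := xget 0 [set c | ord_ge P (f - cst c) 1].

Definition weierstrass Q : set int := [set - Q f | f in RRinf Q `\ 0].

End Curve.

Section Codes.
Variables (k : finFieldType) (n : nat).
Implicit Types (C : set 'rV[k]_n).

Definition is_linear_code C (d : nat) : Prop :=
  exists2 V : {vspace 'rV[k]_n}, C = [set w | w \in V] & \dim V = d.

Definition dual_code C : set 'rV[k]_n :=
  [set w | forall c, C c -> \sum_j c 0 j * w 0 j = 0].

Definition chi (x v : 'rV[k]_n) : 'rV[k]_n := \row_j (x 0 j * v 0 j).

(* Only the terms C_0, ..., C_n of the sequence matter. *)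
Definition isometry_dual (C : nat -> set 'rV[k]_n) : Prop :=
  [/\ forall i, (i < n)%N -> C i `<=` C i.+1,
      forall i, (i <= n)%N -> is_linear_code (C i) i &
      exists2 x : 'rV[k]_n, (forall j, x 0 j != 0) &
        forall i, (i <= n)%N -> chi x @` C i = dual_code (C (n - i)%N)].

End Codes.

Definition card (T : choiceType) (A : set T) : nat := #|` fset_set A|%fset.

Definition minimum (S : set nat) : nat :=
  xget 0%N [set m | S m /\ forall y, S y -> (m <= y)%N].

Section OnePoint.
Variables (k : finFieldType) (X : curve k) (n : nat).
Variables (P : 'I_n -> point X) (Q : point X).

Definition ev (f : ffield X) : 'rV[k]_n := \row_i eval (P i) f.

(* C(D, mQ), D = P_1 + ... + P_n *)
Definition code (m : int) : set 'rV[k]_n := ev @` RR << m *g Q >>.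

Definition Hstar : set int := [set m | 0 <= m /\ code m <> code (m - 1)].

(* m_0 = -1 and, for i > 0, m_i is the i-th smallest element of H^*. *)
Definition hstar (i : nat) : int :=
  if i == 0%N then -1
  else xget 0 [set m | Hstar m /\ card [set h | Hstar h /\ h <= m] = i].

Definition Lambda_star (i : nat) : set int :=
  [set m | Hstar m /\ exists2 mj, Hstar mj & m = hstar i + mj].

Definition d_star (i : nat) : nat :=
  minimum [set card (Lambda_star r) | r in [set r | (1 <= r <= i)%N]].

Definition Aset (h : int) : set int :=
  [set t | weierstrass Q t /\ weierstrass Q (h - t)].

(* The strict order bound of C(D, m_i Q) for genus g, in the form it takes under
   the isometry-dual condition. *)
Definition d_ORD_ev (g i : nat) : nat :=
  minimum [set card (Aset h) | h in
    [set h | Hstar h /\ n%:Z + 2 * g%:Z - 1 - hstar i <= h]].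

End OnePoint.

(* Main.v *)
From mathcomp Require Import all_boot all_order all_algebra.
From mathcomp Require Import finmap zify ring.
From mathcomp Require Import boolp classical_sets cardinality.
From mathcomp Require Import freeg.
Require Import Defs.
Import Order.TTheory GRing.Theory Num.Theory.

(**
Put M = n + 2g - 1.  The theorem follows from the symmetry m |-> M - m of H^*:
it sends {h in H^* | h >= M - m_i} to {m_r | r <= i}, and t |-> m_r + t is then
a bijection from A[M - m_r] onto Lambda^*_r.

The boundedness of deg A - ell(A) + 1 over all divisors A replaces the usual
theory of curves: it forces every L(A) to be finite-dimensional, every place to
have positive finite degree, and deg A >= 0 as soon as L(A) <> 0.  Comparing
L(mQ) with a divisor attaining the maximum g yields ell(mQ) = m + 1 - g for
large m, so H has exactly g gaps, and pairing a with l - a shows that they are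
all smaller than 2g.

If a, b are in H and a + b is in H^*, then a is in H^*; also H and H^* coincide
below n, and H^* has n elements.  Counting decompositions of the largest
element N of H^* gives N <= M.  Conversely, the isometry x defines a nonzero
functional phi(f) = sum_j x_j f(P_j) that kills f_a f_b whenever a, b < n and
a + b < M; a Clifford-type estimate shows that every element of H below M is
such a sum a + b, so phi kills L((M - 1)Q), which therefore does not evaluate
onto F_q^n, and N = M.  The symmetry is then immediate for m < n, and follows
by counting for m >= n.
*)

Set Implicit Arguments.
Unset Strict Implicit.
Unset Printing Implicit Defensive.

Local Open Scope ring_scope.
Local Open Scope classical_set_scope.

(** * Free families in the function field *)

Section FreeFamilies.
Variables (k : finFieldType) (X : curve k).
Local Notation F := (ffield X).
Implicit Types (U V W : set F) (f : F).

Definition subspace U : Prop :=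
  [/\ U 0, forall u v, U u -> U v -> U (u + v) & forall c u, U u -> U (cst c * u)].

(** Linear independence over k of the entries. With columns, a k-linear substitution is a product by
    [map_mx cst A], so ranks and kernels of matrices over k apply. *)
Definition free_col d (b : 'cV[F]_d) : Prop :=
  forall c : 'rV[k]_d, map_mx cst c *m b = 0 -> c = 0.

(** Plays the role of dim U >= d, and makes sense also when U is infinite-dimensional. *)
Definition has_free U d : Prop :=
  exists b : 'cV[F]_d, (forall i, U (b i 0)) /\ free_col b.

Lemma subspace_sum U I (r : seq I) (a : I -> F) :
  subspace U -> (forall i, U (a i)) -> U (\sum_(i <- r) a i).
Proof. by move=> [U0 UD _] Ua; elim/big_rec: _ => // i x _; exact: UD. Qed.

Lemma subspaceB U u v : subspace U -> U u -> U v -> U (u - v).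
Proof.
move=> [_ UD UZ] Uu Uv; apply: UD => //.
by have := UZ (-1) _ Uv; rewrite rmorphN1 mulN1r.
Qed.

Lemma subspace_mulmx U m d (A : 'M[k]_(m, d)) (b : 'cV[F]_d) i :
  subspace U -> (forall i, U (b i 0)) -> U ((map_mx cst A *m b) i 0).
Proof.
move=> sU Ub; rewrite mxE; apply: subspace_sum => // j; rewrite mxE.
by have [_ _] := sU; apply.
Qed.

Lemma free_mulmx m d (A : 'M[k]_(m, d)) (b : 'cV[F]_d) :
  row_free A -> free_col b -> free_col (map_mx cst A *m b).
Proof.
move=> fA fb c; rewrite mulmxA -map_mxM => /fb /eqP.
by rewrite mulmx_free_eq0 // => /eqP.
Qed.

Lemma has_free_mulmx U m d (A : 'M[k]_(m, d)) (b : 'cV[F]_d) :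
  subspace U -> (forall i, U (b i 0)) -> free_col b -> row_free A ->
  has_free U m.
Proof.
move=> sU Ub fb fA; exists (map_mx cst A *m b); split; last exact: free_mulmx.
by move=> i; exact: subspace_mulmx.
Qed.

Lemma has_free_le U r s : subspace U -> has_free U r -> (s <= r)%N -> has_free U s.
Proof.
move=> sU [b [Ub fb]] sr; apply: (@has_free_mulmx U s r (pid_mx s) b) => //.
by rewrite /row_free rank_pid_mx.
Qed.

Lemma has_free0 U : has_free U 0.
Proof.
by exists 0; split=> [[]//|c _]; apply/matrixP=> i [].
Qed.

Lemma has_free_mul U V f r : f != 0 -> (forall u, U u -> V (f * u)) ->
  has_free U r -> has_free V r.
Proof.
move=> f0 UV [b [Ub fb]]; exists (f *: b); split=> [i|c].
  by rewrite mxE; exact: UV.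
by rewrite -scalemxAr => /eqP; rewrite scaler_eq0 (negbTE f0) => /eqP /fb.
Qed.

Lemma has_free_sub U V r : U `<=` V -> has_free U r -> has_free V r.
Proof. by move=> UV [b [Ub fb]]; exists b; split=> // i; exact: UV. Qed.

(** In a linear relation the coefficient of f must vanish, since dividing by it would put f into W;
    what remains is a relation in W. *)
Lemma has_freeS U W f r : subspace W -> W `<=` U -> U f -> ~ W f ->
  has_free W r -> has_free U r.+1.
Proof.
move=> sW WU Uf nWf [b [Wb fb]]; rewrite -add1n.
exists (col_mx (f%:M : 'cV_1) b); split=> [i|c].
  rewrite mxE; case: (splitP i) => j _; last exact/WU/Wb.
  by rewrite mxE !ord1 eqxx.
rewrite -[c]hsubmxK map_row_mx mul_row_col.
have [c0|c0] := eqVneq (lsubmx c) 0.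
  by rewrite c0 map_mx0 mul0mx add0r => /fb ->; rewrite row_mx0.
move=> /(congr1 (fun A : 'M_1 => A 0 0)).
have [a ea] : exists a, lsubmx c = a%:M.
  by exists (lsubmx c 0 0); exact: mx11_scalar.
rewrite ea map_scalar_mx mul_scalar_mx [RHS]mxE [LHS]mxE [X in X + _]mxE.
rewrite [X in _ * X + _]mxE eqxx mulr1n => eq0.
case: nWf.
have a0 : cst a != 0 :> F.
  rewrite fmorph_eq0; apply: contra c0 => /eqP a0.
  by apply/eqP/matrixP=> i j; rewrite ea !mxE a0 mul0rn.
have -> : f = cst (- a^-1) * (map_mx cst (rsubmx c) *m b) 0 0.
  move/eqP: eq0; rewrite addrC addr_eq0 => /eqP ->.
  by rewrite rmorphN fmorphV mulrNN mulKf.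
by have [_ _] := sW; apply; exact: subspace_mulmx.
Qed.

Lemma is_dim_has_free U d : subspace U -> is_dim U [set 0] d -> has_free U d.
Proof.
move=> [U0 _ _] [b [Ub bu]].
exists (\col_i b i); split=> [i|c cb0]; first by rewrite mxE.
have [c0 [_ uc]] := bu 0 U0.
rewrite -(uc 0); last first.
  by rewrite big1 ?subr0 // => i _; rewrite mxE rmorph0 mul0r.
apply: esym; apply: uc => /=; rewrite sub0r.
move/(congr1 (fun A : 'M_1 => A 0 0)): cb0.
rewrite !mxE => e; apply/eqP; rewrite oppr_eq0 -[X in _ == X]e; apply/eqP.
by apply: eq_bigr => i _; rewrite !mxE.
Qed.

(** More than d vectors have a coordinate matrix with nonzero left kernel, and a nonzero row of that
    kernel is a linear relation. *)
Lemma has_free_dim U d r : is_dim U [set 0] d -> has_free U r -> (r <= d)%N.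
Proof.
move=> [b [Ub bu]] [e [Ue fe]]; rewrite leqNgt; apply/negP=> dr.
have /fin_all_exists[C HC] i := bu _ (Ue i).
pose A := \matrix_i C i.
have eA : e = map_mx cst A *m (\col_i b i).
  apply/matrixP=> i j; rewrite ord1; have [] := HC i => /= /eqP.
  rewrite subr_eq0 => /eqP -> _.
  by rewrite mxE; apply: eq_bigr => l _; rewrite !mxE.
have : kermx A != 0.
  by rewrite -mxrank_eq0 mxrank_ker subn_eq0 -ltnNge (leq_ltn_trans (rank_leq_col A)).
case/rowV0Pn=> c cA c0; move/eqP: c0; apply; apply: fe.
by rewrite eA mulmxA -map_mxM (sub_kermxP cA) map_mx0 mul0mx.
Qed.

(** A free family of maximal size spans U: by [has_freeS], an element outside its span would extend
    it. *)
Lemma free_bounded_dim U N : subspace U ->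
  ~ has_free U N.+1 -> exists d, is_dim U [set 0] d.
Proof.
move=> sU nN.
have exd : exists d, `[< has_free U d >] by exists 0%N; apply/asboolP/has_free0.
have bd d : `[< has_free U d >] -> (d <= N)%N.
  move=> /asboolP hd; rewrite leqNgt; apply/negP=> Nd; exact/nN/(has_free_le sU hd).
have [d /asboolP [b [Ub fb]] dmax] := ex_maxnP exd bd.
exists d, (fun i => b i 0); split=> // u Uu.
have comb (c : 'rV[k]_d) : \sum_i cst (c 0 i) * b i 0 = (map_mx cst c *m b) 0 0.
  by rewrite mxE; apply: eq_bigr => i _; rewrite mxE.
have [[c ec]|nc] := pselect (exists c : 'rV[k]_d, u = (map_mx cst c *m b) 0 0).
  exists c; split=> [/=|c' /= /eqP]; first by rewrite comb ec subrr.
  rewrite comb ec subr_eq0 => /eqP e; apply/eqP; rewrite -subr_eq0; apply/eqP/fb.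
  rewrite map_mxB mulmxBl; apply/matrixP=> i j.
  by rewrite !ord1 [LHS]mxE [X in _ + X]mxE e subrr mxE.
pose W := [set w | exists c : 'rV[k]_d, w = (map_mx cst c *m b) 0 0].
have sW : subspace W.
  split; first by exists 0; rewrite map_mx0 mul0mx mxE.
    by move=> _ _ [c ->] [c' ->]; exists (c + c'); rewrite map_mxD mulmxDl [RHS]mxE.
  by move=> a _ [c ->]; exists (a *: c); rewrite map_mxZ -scalemxAl [RHS]mxE.
have WU : W `<=` U by move=> _ [c ->]; exact: subspace_mulmx.
suff : has_free U d.+1 by move=> /asboolP/dmax; rewrite ltnn.
apply: (has_freeS sW WU Uu nc); exists b; split=> // i.
exists (delta_mx 0 i); rewrite map_delta_mx -rowE mxE //.
Qed.

(** The elements u of U with t u in W form the kernel of a map from U to V / W, which has dimension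
    p, so at most p dimensions are lost. *)
Lemma has_free_quotient U U' V W t p r : subspace U -> subspace W ->
  is_dim V W p -> (forall u, U u -> V (t * u)) ->
  (forall u, U u -> W (t * u) -> U' u) -> has_free U r -> has_free U' (r - p).
Proof.
move=> sU sW [e [Ve eu]] UV UU' [b [Ub fb]].
have /fin_all_exists[C HC] i := eu _ (UV _ (Ub i)).
pose A := \matrix_i C i.
have rk : (r - p <= \rank (kermx A))%N by rewrite mxrank_ker leq_sub2l // rank_leq_col.
pose U1 := [set u | U u /\ W (t * u)].
have sU1 : subspace U1.
  case: sU sW => U0 UD UZ [W0 WD WZ]; split; first by rewrite /U1 /= mulr0.
    by move=> u v [? ?] [? ?]; split; [exact: UD | rewrite mulrDr; exact: WD].
  by move=> c u [? ?]; split; [exact: UZ | rewrite mulrCA; exact: WZ].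
suff : has_free U1 (r - p) by apply: has_free_sub => u [? ?]; exact: UU'.
apply: has_free_le rk => //.
pose B := row_base (kermx A).
exists (map_mx cst B *m b); split; last exact: (free_mulmx (row_base_free _) fb).
move=> i; split; first exact: subspace_mulmx.
have BA : B *m A = 0 by apply/sub_kermxP; rewrite eq_row_base.
(* The rows of B kill the coordinate matrix A, so each t b_j may be replaced by its remainder, which
   lies in W. *)
have -> : t * (map_mx cst B *m b) i 0 =
   (map_mx cst B *m (t *: b - map_mx cst A *m \col_i e i)) i 0.
  by rewrite mulmxBr mulmxA -map_mxM BA map_mx0 mul0mx subr0 -scalemxAr [RHS]mxE.
apply: subspace_mulmx => // j; have [+ _] := HC j.
rewrite /= [X in W X -> _](_ : _ = (t *: b - map_mx cst A *m \col_i e i) j 0) //.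
rewrite !mxE; congr (_ - _); apply: eq_bigr => l _; by rewrite !mxE.
Qed.

End FreeFamilies.

(** * Riemann-Roch spaces *)

Section Orders.
Variables (k : finFieldType) (X : curve k).
Local Notation F := (ffield X).
Implicit Types (P Q : point X) (f h : F) (A B : divisor X).

Lemma ord_one P : P 1 = 0.
Proof. by rewrite -(rmorph1 cst) ord_cst. Qed.

Lemma ordV P f : f != 0 -> P f^-1 = - P f.
Proof.
move=> f0; apply/eqP; rewrite -addr_eq0 addrC -ordM ?invr_eq0 //.
by rewrite divff // ord_one.
Qed.

Lemma ord_geP P f z : f != 0 -> ord_ge P f z <-> z <= P f.
Proof. by move=> f0; split=> [[/eqP|//]|]; [rewrite (negPf f0)|right]. Qed.

Lemma ord_ge_le P f y z : y <= z -> ord_ge P f z -> ord_ge P f y.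
Proof. by move=> yz [->|zf]; [left|right; exact: le_trans zf]. Qed.

Lemma ord_geD P f h z : ord_ge P f z -> ord_ge P h z -> ord_ge P (f + h) z.
Proof.
have [->|f0] := eqVneq f 0; first by rewrite add0r.
have [->|h0] := eqVneq h 0; first by rewrite addr0.
have [->|fh0] := eqVneq (f + h) 0; first by left.
rewrite !ord_geP // => zf zh; apply: le_trans (ordD P f0 h0 fh0).
by rewrite le_min zf.
Qed.

Lemma ord_geM P f h y z : ord_ge P f y -> ord_ge P h z -> ord_ge P (f * h) (y + z).
Proof.
have [->|f0] := eqVneq f 0; first by left; rewrite mul0r.
have [->|h0] := eqVneq h 0; first by left; rewrite mulr0.
by rewrite !ord_geP ?mulf_neq0 // => zf zh; rewrite ordM // lerD.
Qed.

Lemma ord_ge_cst P c : ord_ge P (cst c) 0.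
Proof. by right; rewrite ord_cst. Qed.

Lemma ord_geZ P f z c : ord_ge P f z -> ord_ge P (cst c * f) z.
Proof. by move/(ord_geM (ord_ge_cst P c)); rewrite add0r. Qed.

Lemma subspace_ord_ge P z : subspace [set f | ord_ge P f z].
Proof. by split=> [|f h|c f]; [left|exact: ord_geD|exact: ord_geZ]. Qed.

Lemma subspace_RR A : subspace (RR A).
Proof.
split=> [P|f h Af Ah P|c f Af P]; first by left.
  exact: ord_geD.
exact: ord_geZ.
Qed.

Lemma RR_le A B : (forall P, coeff P A <= coeff P B) -> RR A `<=` RR B.
Proof. by move=> AB f Af P; apply: ord_ge_le (Af P); rewrite lerN2. Qed.

Lemma RRM A B f h : RR A f -> RR B h -> RR (A + B) (f * h).
Proof. by move=> Af Bh P; rewrite coeffD opprD; exact: ord_geM. Qed.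

Lemma RRX A f s : RR A f -> RR (A *+ s) (f ^+ s).
Proof.
move=> Af; elim: s => [|s IH]; last by rewrite exprS mulrS; exact: RRM.
by rewrite expr0 => P; right; rewrite ord_one mulr0n coeff0 oppr0.
Qed.

Lemma ddegB A B : ddeg (A - B) = ddeg A - ddeg B.
Proof. exact: (lift_is_additive (fun P => (pdeg P)%:Z : int^o)). Qed.

Lemma ddeg0 : ddeg (0 : divisor X) = 0.
Proof. by rewrite -(subrr 0) ddegB subrr. Qed.

Lemma ddegN A : ddeg (- A) = - ddeg A.
Proof. by rewrite -(sub0r A) ddegB ddeg0 sub0r. Qed.

Lemma ddegD A B : ddeg (A + B) = ddeg A + ddeg B.
Proof. by rewrite -{1}(opprK B) ddegB ddegN opprK. Qed.

Lemma ddegMn A s : ddeg (A *+ s) = ddeg A *+ s.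
Proof. by elim: s => [|s IH]; rewrite ?ddeg0 // !mulrS ddegD IH. Qed.

Lemma ddegU z P : ddeg << z *g P >> = z * (pdeg P)%:Z.
Proof. by rewrite /ddeg liftU. Qed.

Lemma xgetP0 (S : set nat) : xget 0%N S != 0%N -> S (xget 0%N S).
Proof. by case: xgetP => [x -> //|]; rewrite eqxx. Qed.

Lemma pdeg_gt0_dim P : (0 < pdeg P)%N ->
  is_dim [set f | ord_ge P f 0] [set f | ord_ge P f 1] (pdeg P).
Proof. by rewrite lt0n => /xgetP0. Qed.

End Orders.

(** * Riemann-Roch theory drawn from the genus bound *)

Section Genus.
Variables (k : finFieldType) (X : curve k) (g : nat) (Q : point X).
Hypotheses (genus_X : has_genus X g) (Q_rational : rational Q).
Local Notation F := (ffield X).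
Implicit Types (P : point X) (f h : F) (A B : divisor X).

(** A nonzero value of [ell] would be a true dimension and bound the free families, so only the
    default value 0 remains. *)
Lemma ell_infinite A : (forall r, has_free (RR A) r) -> ell A = 0%N.
Proof.
move=> inf; apply/eqP/negP=> /negP /xgetP0 /has_free_dim /(_ (inf (ell A).+1)).
by rewrite ltnn.
Qed.

(** If L(A) were infinite-dimensional, so would be L(A + sQ) for s >= 0; its [ell] would be the
    default 0 while its degree grows with s, against the genus bound. *)
Lemma RR_dim A : is_dim (RR A) [set 0] (ell A).
Proof.
have [[d Ad]|nd] := pselect (exists d, is_dim (RR A) [set 0] d).
  by rewrite /ell /dimq; case: xgetP => // /(_ d).
have inf r : has_free (RR A) r.
  case: r => [|r]; first exact: has_free0.
  apply: contrapT => nr; apply: nd; exact: free_bounded_dim (subspace_RR A) nr.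
pose s := (g + `|ddeg A|)%N.
have := genus_X.1 (A + << s%:Z *g Q >>).
rewrite ell_infinite => [|r].
  rewrite ddegD ddegU Q_rational mulr1 /s; lia.
apply: has_free_sub (inf r); apply: RR_le => P.
by rewrite coeffD coeffU lerDl mulr_ge0.
Qed.

Lemma has_free_ell A r : has_free (RR A) r <-> (r <= ell A)%N.
Proof.
split; first exact: has_free_dim (RR_dim A).
by apply: has_free_le (subspace_RR A) (is_dim_has_free (subspace_RR A) (RR_dim A)).
Qed.

Lemma riemann A : ddeg A + 1 <= g%:Z + (ell A)%:Z.
Proof. by have := genus_X.1 A; lia. Qed.

Lemma ell_gt0 A : (0 < ell A)%N -> exists2 f, f != 0 & RR A f.
Proof.
move=> /has_free_ell [b [Ab fb]]; exists (b 0 0) => //.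
apply/eqP => b0; have /(_ 1) : free_col b := fb.
rewrite (_ : b = 0) ?mulmx0 => [/(_ erefl)/eqP|]; first by rewrite oner_eq0.
by apply/matrixP=> i j; rewrite !ord1 b0 mxE.
Qed.

Lemma ell_mul A B f :
  f != 0 -> (forall h, RR A h -> RR B (f * h)) -> (ell A <= ell B)%N.
Proof. by move=> f0 AB; apply/has_free_ell/(has_free_mul f0 AB)/has_free_ell. Qed.

(* If f had more zeros than poles, the powers of f would embed L(-sA) into
   L(0), whereas ell(-sA) is unbounded. *)
Lemma ddeg_ge0 A f : f != 0 -> RR A f -> 0 <= ddeg A.
Proof.
move=> f0 Af; rewrite leNgt; apply/negP=> A0.
pose s := (g + ell (0%R : divisor X))%N.
have : (ell (- A *+ s)%R <= ell (0%R : divisor X))%N.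
  apply: (@ell_mul _ _ (f ^+ s)) => [|h Ah]; first exact: expf_neq0.
  by rewrite -(subrr (A *+ s)) -mulNrn; apply: RRM => //; exact: RRX.
have := riemann (- A *+ s).
rewrite ddegMn ddegN -mulr_natr /s; set e := ell _; set e' := ell _; nia.
Qed.

(* [pdeg P] is 0 exactly when the residue field is infinite over k; in that case
   no L(gQ - NP) vanishes, which makes L(gQ) infinite-dimensional. *)
Lemma pdeg_gt0 P : (0 < pdeg P)%N.
Proof.
rewrite lt0n; apply/negP=> /eqP P0.
pose B N := << g%:Z *g Q >> - << N%:Z *g P >> : divisor X.
have B0 N : exists2 f, f != 0 & RR (B N) f.
  apply: ell_gt0; have := riemann (B N).
  rewrite /B ddegD ddegN !ddegU P0 Q_rational; lia.
have BS M N : (M <= N)%N -> RR (B N) `<=` RR (B M).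
  move=> MN; apply: RR_le => P'; rewrite !coeffB !coeffU.
  by rewrite lerD2l lerN2 ler_wpM2r.
suff inf r N : has_free (RR (B N)) r.
  by have /has_free_ell := inf (ell (B 0%N)).+1 0%N; rewrite ltnn.
elim: r N => [|r IH] N; first exact: has_free0.
have [f f0 Bf] := B0 N.
(* M - g exceeds the order of f at P, so f is outside L(gQ - MP) even if P = Q. *)
pose M := (N + `|P f| + g + 1)%N.
apply: (@has_freeS _ _ (RR (B N)) (RR (B M)) f) => //.
- exact: subspace_RR.
- by apply: BS; rewrite /M; lia.
move=> /(_ P); rewrite ord_geP // coeffB !coeffU eqxx mulr1 /M.
case: (Q == P); lia.
Qed.

(** For t of order [coeff P A + 1] at P, multiplication by t maps L(A + P) into O_P, and u lies in
    L(A) as soon as t u lies in M_P. The codimension is then at most that of M_P in O_P, which is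
    [pdeg P]. *)
Lemma ell_addP A P : (ell (A + << 1 *g P >>)%R <= ell A + pdeg P)%N.
Proof.
have [t0 Pt0] := ord_normalized P.
have t0N : t0 != 0 by apply/eqP=> t00; move: Pt0; rewrite t00 ord0.
pose a := coeff P A + 1.
have [t tN Pt] : exists2 t, t != 0 & P t = a.
  exists (t0 ^ a); first exact: expfz_neq0.
  have ordX s : P (t0 ^+ s) = s%:Z.
    elim: s => [|s IH]; first by rewrite expr0 ord_one.
    by rewrite exprS ordM ?expf_neq0 // IH Pt0; lia.
  case: a => s; first by rewrite -exprnP ordX.
  by rewrite NegzE -exprnN ordV ?expf_neq0 // ordX.
rewrite addnC -leq_subLR; apply/has_free_ell.
apply: (@has_free_quotient _ _ (RR (A + << 1 *g P >>)) _ [set f | ord_ge P f 0]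
  [set f | ord_ge P f 1] t).
- exact: subspace_RR.
- exact: subspace_ord_ge.
- exact/pdeg_gt0_dim/pdeg_gt0.
- move=> u /(_ P); rewrite coeffD coeffU eqxx mulr1 => Au.
  have : ord_ge P t a by right; rewrite Pt.
  by move=> /ord_geM /(_ Au); rewrite subrr.
- move=> u Au /= tu P'.
  have := Au P'; rewrite coeffD coeffU; have [PP'|PP'] := eqVneq P P'; last first.
    by rewrite mulr0 addr0.
  rewrite -PP' => _; case: tu => [/eqP|tu].
    by rewrite mulf_eq0 (negPf tN) => /eqP; left.
  have [->|u0] := eqVneq u 0; first by left.
  right; move: tu; rewrite ordM // Pt /a; lia.
- exact/has_free_ell.
Qed.

Lemma ell_oneS m : (ell << (m + 1)%R *g Q >> <= (ell << m *g Q >>).+1)%N.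
Proof. by have := ell_addP << m *g Q >> Q; rewrite freegUD Q_rational addn1. Qed.

(** An effective divisor, as a list of points with repetitions, for induction point by point. *)
Definition sumP (s : seq (point X)) : divisor X := \sum_(P <- s) << 1 *g P >>.

Lemma sumP_cons P s : sumP (P :: s) = << 1 *g P >> + sumP s.
Proof. by rewrite /sumP big_cons. Qed.

Lemma coeff_sumP P s : coeff P (sumP s) = (count_mem P s)%:Z.
Proof.
elim: s => [|P' s IH]; first by rewrite /sumP big_nil coeff0.
by rewrite sumP_cons coeffD coeffU IH mul1r natz.
Qed.

Lemma ddeg_sumP s : {in s, forall P, rational P} -> ddeg (sumP s) = (size s)%:Z.
Proof.
elim: s => [|P s IH] rs; first by rewrite /sumP big_nil ddeg0.
rewrite sumP_cons ddegD ddegU (rs P) ?mem_head // IH ?mul1r // => P' Ps.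
by apply: rs; rewrite in_cons Ps orbT.
Qed.

Lemma ell_sumP A s : (ell (A + sumP s))%:Z <= (ell A)%:Z + ddeg (sumP s).
Proof.
elim: s A => [|P s IH] A; first by rewrite /sumP big_nil addr0 ddeg0 addr0.
have := IH (A + << 1 *g P >>); have := ell_addP A P.
rewrite sumP_cons addrA ddegD ddegU mul1r.
by move=> AP /le_trans; apply; rewrite addrA lerD2r -PoszD lez_nat.
Qed.

(** Riemann's inequality bounds ell(mQ) from below. For the upper bound take A0 attaining the genus
    and f in L(mQ - A0): division by f embeds L(mQ) into L(A0 + E), where E is effective of degree
    at most m - deg A0. *)
Lemma ell_large : exists m0 : int,
  forall m, m0 <= m -> (ell << m *g Q >>)%:Z = m + 1 - g%:Z.
Proof.
have [A0 eA0] := genus_X.2.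
exists (ddeg A0 + g%:Z) => m mA0; apply/eqP; rewrite eq_le; apply/andP.
split; last first.
  by have := riemann << m *g Q >>; rewrite ddegU Q_rational; lia.
pose A := << m *g Q >> - A0.
have dA : ddeg A = m - ddeg A0 by rewrite ddegD ddegN ddegU Q_rational mulr1.
have [f f0 Af] : exists2 f, f != 0 & RR A f.
  by apply: ell_gt0; have := riemann A; rewrite dA; lia.
(* A maximal effective [sumP s] such that f is in L(A - sumP s): then
   (f) = sumP s - A, which has degree 0. *)
pose good d := `[< exists2 s, ddeg (sumP s) = d%:Z & RR (A - sumP s) f >].
have ex : exists d, good d.
  exists 0%N; apply/asboolP; exists [::]; rewrite /sumP big_nil ?ddeg0 //.
  by rewrite subr0.
have bnd d : good d -> (d <= `|ddeg A|)%N.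
  move=> /asboolP[s sd] /(ddeg_ge0 f0); rewrite ddegD ddegN sd; lia.
have aux (c v : int) : - c < v -> - (- 1 + c) <= v by lia.
have [d /asboolP[s sd Asf] dmax] := ex_maxnP ex bnd.
have Vf P : P f = - coeff P (A - sumP s).
  apply/eqP; rewrite eq_le andbC; have /(ord_geP _ _ f0) -> := Asf P.
  rewrite leNgt; apply/negP => Pf.
  have /dmax : good (d + pdeg P)%N.
    apply/asboolP; exists (P :: s).
      by rewrite sumP_cons ddegD sd ddegU mul1r addrC.
    move=> P'; rewrite ord_geP // sumP_cons opprD addrCA coeffD coeffN coeffU.
    have [<-|PP'] := eqVneq P P'; first by rewrite mulr1; exact: (aux _ _ Pf).
    by have /(ord_geP _ _ f0) := Asf P'; rewrite mulr0 oppr0 add0r.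
  by have := pdeg_gt0 P; lia.
have : (ell << m *g Q >> <= ell (A0 + sumP s)%R)%N.
  apply: (@ell_mul _ _ f^-1); first by rewrite invr_eq0.
  move=> h mh P; have := mh P.
  have : ord_ge P f^-1 (coeff P (A - sumP s)) by right; rewrite ordV // Vf opprK.
  move=> /ord_geM H /H; congr (ord_ge _ _ _); rewrite /A !(coeffB, coeffD); lia.
have := ell_sumP A0 s.
have : 0 <= ddeg (A - sumP s) by exact: ddeg_ge0 Asf.
rewrite ddegD ddegN dA; lia.
Qed.

End Genus.

(** * Numerical semigroups *)

Section NatSums.
Local Open Scope nat_scope.

Lemma leq_sum_gt0 b c (F : nat -> nat) :
  (forall i, b <= i < c -> 0 < F i) -> c - b <= \sum_(b <= i < c) F i.
Proof.
move=> F1; rewrite -[c - b]muln1 -sum_nat_const_nat !big_nat.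
exact: leq_sum.
Qed.

Lemma sum_eq1 b c (F : nat -> nat) :
  (forall i, b <= i < c -> F i = 1) -> \sum_(b <= i < c) F i = c - b.
Proof. by move=> F1; rewrite (eq_big_nat _ _ F1) sum_nat_const_nat muln1. Qed.

End NatSums.

Section Semigroup.
Local Open Scope nat_scope.
Variables (H : pred nat) (g : nat).
Hypothesis (HD : forall a b, H a -> H b -> H (a + b)).

Definition gaps c := \sum_(0 <= i < c) ~~ H i.

Hypothesis gaps_large : exists c0, forall c, c0 <= c -> gaps c = g.

Lemma gaps_cat b c : b <= c -> gaps c = gaps b + \sum_(b <= i < c) ~~ H i.
Proof. by move=> bc; rewrite /gaps (big_cat_nat (n := b)). Qed.

Lemma gapsS c : gaps c.+1 = gaps c + ~~ H c.
Proof. by rewrite /gaps big_nat_recr. Qed.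

Lemma leq_gaps c : gaps c <= g.
Proof.
have [c0 /(_ (maxn c c0))] := gaps_large; rewrite leq_maxr => <- //.
by rewrite (gaps_cat (leq_maxl c c0)) leq_addr.
Qed.

(* Of two numbers whose sum is not in H, at least one is a gap. *)
Lemma gap_lt l : ~~ H l -> l < (gaps l.+1).*2.
Proof.
move=> Hl; rewrite -addnn {2}/gaps big_nat_rev -big_split /=.
rewrite -[X in X <= _]subn0; apply: leq_sum_gt0 => i /andP[_ il].
rewrite add0n subSS.
case: (boolP (H i)) => //= Hi; case: (boolP (H (l - i))) => //= Hli.
by move: (HD Hi Hli); rewrite subnKC // (negPf Hl).
Qed.

Lemma mem_large c : g.*2 <= c -> H c.
Proof.
move=> gc; apply: contraLR gc => /gap_lt lc; rewrite -ltnNge.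
by apply: leq_trans lc _; rewrite leq_double leq_gaps.
Qed.

Lemma gaps_conductor c : g.*2 <= c -> gaps c = g.
Proof.
move=> gc; have [c0 /(_ (maxn c c0))] := gaps_large; rewrite leq_maxr => <- //.
rewrite (gaps_cat (leq_maxl c c0)) [X in _ + X]big_nat_cond big1 ?addn0 // => i.
by rewrite andbT => /andP[ci _]; rewrite mem_large // (leq_trans gc).
Qed.

(* An analogue of Clifford's theorem. *)
Lemma gaps_half c : gaps c = g \/ c <= (gaps c).*2.+1.
Proof.
have [[l cl Hl]|noH] := pselect (exists2 l, c <= l & ~~ H l); last first.
  left; have [c0 /(_ (maxn c c0))] := gaps_large; rewrite leq_maxr => <- //.
  rewrite (gaps_cat (leq_maxl c c0)) [X in _ + X]big_nat_cond big1 ?addn0 // => i.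
  rewrite andbT => /andP[ci _]; case: (boolP (H i)) => // Hi.
  by case: noH; exists i.
right; have exl : exists l, (c <= l) && ~~ H l by exists l; rewrite cl.
(* For the least gap m >= c, [gaps m.+1] is [gaps c + 1], and [gap_lt] bounds m. *)
case: (ex_minnP exl) => m /andP[cm Hm] mmin.
have := gap_lt Hm; rewrite gapsS Hm (gaps_cat cm).
rewrite [X in gaps c + X]big_nat_cond big1; first by lia.
move=> i; rewrite andbT => /andP[ci im]; case: (boolP (H i)) => // Hi.
by have := mmin i; rewrite ci Hi => /(_ isT); rewrite leqNgt im.
Qed.

(** For h >= n put t = h - n + 1. Without such a sum, each pair i, h - i in [t, n) contains a gap,
    so n - t <= 2 (g - gaps t); [gaps_half] at t excludes this. *)
Lemma semigroup_sum n h : H 0 -> g.*2.+2 < n -> H h -> h < n + g.*2 - 1 ->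
  exists a b, [/\ H a, H b, a + b = h & a < n /\ b < n].
Proof.
move=> H0 gn Hh hlt; have [hn|nh] := ltnP h n.
  by exists h, 0; split=> //; [rewrite addn0|split=> //; lia].
apply: contrapT => nex.
pose t := h - n.-1.
have tn : t <= n by rewrite /t; lia.
have : n - t <= (\sum_(t <= i < n) ~~ H i).*2.
  rewrite -addnn {2}big_nat_rev -big_split /=.
  apply: leq_sum_gt0 => i /andP[ti iN].
  have -> : t + n - i.+1 = h - i by rewrite /t; lia.
  case: (boolP (H i)) => //= Hi; case: (boolP (H (h - i))) => //= Hhi.
  by case: nex; exists i, (h - i); split=> //; [|split]; move: ti; rewrite /t; lia.
have := gaps_conductor (c := n); rewrite (gaps_cat tn).
by have := gaps_half t; rewrite /t; lia.
Qed.

(** * Subsets of a semigroup with the properties of H^* *)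

Section Star.
Variables (Hs : pred nat) (n : nat).
Hypothesis Hs_ideal : forall a b, H a -> H b -> Hs (a + b) -> Hs a.
Hypothesis Hs_card : forall c, \sum_(0 <= i < c) Hs i <= n.

(** For each i <= a, either i is a gap, or a - i is a gap, or i is in [Hs] by the ideal property.
    These cases occur at most g, g and n times. *)
Lemma star_le a : Hs a -> a < n + g.*2.
Proof.
move=> Ha; have : a.+1 <= (gaps a.+1).*2 + \sum_(0 <= i < a.+1) Hs i.
  rewrite -addnn {2}/gaps big_nat_rev -!big_split /=.
  rewrite -[X in X <= _]subn0; apply: leq_sum_gt0 => i /andP[_ il].
  rewrite add0n subSS.
  case: (boolP (H i)) => //= Hi; case: (boolP (H (a - i))) => //= Hai.
  by rewrite (Hs_ideal Hi Hai) // subnKC.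
by have := leq_gaps a.+1; have := Hs_card a.+1; lia.
Qed.

Hypotheses (HsH : forall a, Hs a -> H a) (gn : g.*2.+2 < n).
Hypothesis Hs_small : forall a, H a -> a < n -> Hs a.
Hypothesis Hs_max : Hs (n + g.*2 - 1).
Hypothesis Hs_total : \sum_(0 <= i < n + g.*2) Hs i = n.

(** If i and M - i are in H, where M = n + 2g - 1, the ideal property at M puts i in [Hs]. This
    settles a < n, where M - a >= 2g lies in H; for a >= n it remains to show that M - a is in H. *)
Lemma star_sym a : Hs a -> Hs (n + g.*2 - 1 - a).
Proof.
move=> Ha; have aM := star_le Ha.
have sym i : i < n + g.*2 -> H i -> H (n + g.*2 - 1 - i) -> Hs i.
  by move=> iM Hi Hi'; apply: (Hs_ideal (b := n + g.*2 - 1 - i)) => //;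
    rewrite subnKC //; lia.
have [an|na] := ltnP a n.
  have Hi' : H (n + g.*2 - 1 - a) by apply: mem_large; lia.
  apply: sym => //; first by lia.
  by rewrite subKn ?HsH //; lia.
suff HMa : H (n + g.*2 - 1 - a) by apply: Hs_small => //; lia.
(* In [n, n + 2g) both [Hs] and the reflection of H have exactly g elements, and the reflection is
   contained in [Hs] by [sym]. A failure at a would make this inclusion strict. *)
have Hs_lt : \sum_(0 <= i < n) Hs i + g = n.
  have <- : gaps n = g by apply: gaps_conductor; lia.
  rewrite -big_split /= -[RHS]subn0; apply: sum_eq1 => i /andP[_ iN].
  case: (boolP (H i)) => Hi; first by rewrite Hs_small.
  by rewrite (negPf (contra (@HsH i) Hi)).
have Hs_ge : \sum_(n <= i < n + g.*2) Hs i = g.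
  by move: Hs_total; rewrite (big_cat_nat (n := n)) //=; lia.
have H_ge : \sum_(n <= i < n + g.*2) H (n + g.*2 - 1 - i) = g.
  have : gaps g.*2 + \sum_(0 <= i < g.*2) H i = g.*2.
    rewrite -big_split /= -[RHS]subn0; apply: sum_eq1 => i _.
    by case: (H i).
  rewrite gaps_conductor // => e.
  have -> : \sum_(n <= i < n + g.*2) H (n + g.*2 - 1 - i) = \sum_(0 <= i < g.*2) H i.
    rewrite [RHS]big_nat_rev -{1}(add0n n) [n + _]addnC big_addn addnK /=.
    by apply: eq_bigr => i _; congr (nat_of_bool (H _)); lia.
  lia.
have le_ge i : n <= i < n + g.*2 -> (H (n + g.*2 - 1 - i) <= Hs i)%N.
  move=> /andP[ni iM]; case Hi: (H (n + g.*2 - 1 - i)) => //; rewrite sym //.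
  by apply: mem_large; lia.
apply: contraT => HMa; suff : g < g by rewrite ltnn.
rewrite -[X in X < _]H_ge -[X in _ < X]Hs_ge.
have aI : n <= a < n + g.*2 by rewrite na.
rewrite [ltnLHS](big_cat_nat (n := a)) ?[ltnRHS](big_cat_nat (n := a)) //=; try lia.
rewrite [X in _ + X < _]big_ltn // [X in _ < _ + X]big_ltn // (negPf HMa) Ha.
rewrite add0n add1n addnS ltnS leq_add //.
  by rewrite !big_nat; apply: leq_sum => i iI; apply: le_ge; lia.
by rewrite !big_nat; apply: leq_sum => i iI; apply: le_ge; lia.
Qed.

End Star.
End Semigroup.

(** * One-point codes *)

Lemma set_natE (A : set int) (p : pred nat) (c : nat) :
  (forall z, A z <-> exists a : nat, [/\ z = a%:Z, (a < c)%N & p a]) ->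
  A = [set` [fset z | z in [seq a%:Z | a <- iota 0 c & p a]]%fset].
Proof.
move=> Ap; apply/seteqP; split=> z /=; rewrite inE /=.
  move=> /Ap[a [-> ac pa]]; apply/mapP; exists a => //.
  by rewrite mem_filter pa mem_iota.
by move=> /mapP[a]; rewrite mem_filter mem_iota => /andP[pa ac] ->; apply/Ap; exists a.
Qed.

Lemma card_nat (A : set int) (p : pred nat) (c : nat) :
  (forall z, A z <-> exists a : nat, [/\ z = a%:Z, (a < c)%N & p a]) ->
  card A = (\sum_(0 <= i < c) p i)%N.
Proof.
move=> /set_natE ->; rewrite /card set_fsetK card_fseq undup_id; last first.
  by rewrite map_inj_uniq ?filter_uniq ?iota_uniq // => a b [].
rewrite size_map size_filter -sum1_count big_mkcond /index_iota subn0.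
by apply: eq_bigr => i _; case: (p i).
Qed.

Lemma card_injective_image (A : set int) (f : int -> int) :
  injective f -> finite_set A -> card (f @` A) = card A.
Proof.
by move=> fi Af; rewrite /card fset_set_image // card_imfset.
Qed.

(** * Evaluation at a rational point *)

Section Eval.
Variables (k : finFieldType) (X : curve k) (P : point X).
Hypothesis P_rational : rational P.
Local Notation F := (ffield X).
Implicit Types (f h : F).

Lemma ord_ge_cst1 c : ord_ge P (cst c) 1 -> c = 0.
Proof.
by case=> [/eqP|]; [rewrite fmorph_eq0 => /eqP|rewrite ord_cst].
Qed.

(** The residue field is a line spanned by e 0. The constant is the quotient of the coordinate cf of
    f by the coordinate c1 of 1, which is nonzero because 1 does not vanish at P. *)
Lemma eval_ex f : ord_ge P f 0 -> exists c, ord_ge P (f - cst c) 1.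
Proof.
move=> f0; have : (0 < pdeg P)%N by rewrite P_rational.
move=> /pdeg_gt0_dim; rewrite P_rational => -[e [_ eu]].
have sW := subspace_ord_ge P 1; have [_ _ WZ] := sW.
have comb h : ord_ge P h 0 -> exists c, ord_ge P (h - cst c * e 0) 1.
  by move=> /eu [c [+ _]]; rewrite /= big_ord1; exists (c 0 0).
have [c1 H1] : exists c, ord_ge P (1 - cst c * e 0) 1.
  by apply: comb; right; rewrite ord_one.
have [cf Hf] := comb _ f0.
have c10 : c1 != 0.
  apply/eqP=> c10; move: H1; rewrite c10 rmorph0 mul0r subr0 -(rmorph1 cst).
  by move=> /ord_ge_cst1/eqP; rewrite oner_eq0.
exists (cf / c1).
have -> : f - cst (cf / c1) = (f - cst cf * e 0) - cst (cf / c1) * (1 - cst c1 * e 0).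
  by rewrite mulrBr mulr1 mulrA -rmorphM divfK // opprB addrA subrK.
by have := subspaceB sW Hf (WZ (cf / c1) _ H1).
Qed.

Lemma evalP f : ord_ge P f 0 -> ord_ge P (f - cst (eval P f)) 1.
Proof.
by move=> /eval_ex [c fc]; rewrite /eval; case: xgetP => [d _ //|/(_ c)].
Qed.

Lemma eval_unique f c : ord_ge P (f - cst c) 1 -> eval P f = c.
Proof.
rewrite /eval; case: xgetP => [d _ fd fc|/(_ c)//].
apply/eqP; rewrite -subr_eq0; apply/eqP/ord_ge_cst1.
have := subspaceB (subspace_ord_ge P 1) fc fd.
by rewrite /= opprB addrC addrA subrK rmorphB.
Qed.

Lemma evalD f h : ord_ge P f 0 -> ord_ge P h 0 ->
  eval P (f + h) = eval P f + eval P h.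
Proof.
move=> /evalP f0 /evalP h0; apply: eval_unique.
by rewrite rmorphD opprD addrACA; exact: ord_geD.
Qed.

Lemma evalM f h : ord_ge P f 0 -> ord_ge P h 0 ->
  eval P (f * h) = eval P f * eval P h.
Proof.
move=> f0 h0; have := evalP f0; have := evalP h0.
set a := eval P f; set b := eval P h => hb fa; apply: eval_unique.
have -> : f * h - cst (a * b) = (f - cst a) * h + cst a * (h - cst b).
  by rewrite rmorphM mulrBl mulrBr addrA subrK.
by apply: ord_geD; [have := ord_geM fa h0; rewrite addr0|exact: ord_geZ].
Qed.

Lemma eval_cst c : eval P (cst c) = c.
Proof. by apply: eval_unique; left; rewrite subrr. Qed.

Lemma eval_eq0 f : ord_ge P f 0 -> eval P f = 0 -> ord_ge P f 1.
Proof. by move=> /evalP + f0; rewrite f0 rmorph0 subr0. Qed.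

End Eval.

(** * Functions regular outside Q and the Weierstrass semigroup *)

Section OnePoint.
Variables (k : finFieldType) (X : curve k) (g n : nat).
Variables (P : 'I_n -> point X) (Q : point X).
Hypotheses (genus_X : has_genus X g) (Q_rational : rational Q).
Local Notation F := (ffield X).
Local Notation L m := (RR << m *g Q >>).
Implicit Types (f h u : F) (m : int).

Lemma RR_oneP m f :
  L m f <-> (forall P', P' <> Q -> ord_ge P' f 0) /\ ord_ge Q f (- m).
Proof.
split=> [mf|[f0 fm] P'].
  split=> [P' P'Q|]; last by have := mf Q; rewrite coeffU eqxx mulr1.
  by have := mf P'; rewrite coeffU; case: eqVneq => [/esym//|_]; rewrite mulr0 oppr0.
rewrite coeffU; have [<-|QP] := eqVneq Q P'; first by rewrite mulr1.
by rewrite mulr0 oppr0; apply: f0 => /esym/eqP; rewrite (negPf QP).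
Qed.

Lemma RR_one_le m m' : m <= m' -> L m `<=` L m'.
Proof.
move=> mm f /RR_oneP [f0 fm]; apply/RR_oneP; split=> //.
by apply: ord_ge_le fm; rewrite lerN2.
Qed.

Lemma RR_one_lt0 m f : m < 0 -> L m f -> f = 0.
Proof.
move=> m0 mf; apply/eqP/contraT => f0.
by have := ddeg_ge0 genus_X Q_rational f0 mf; rewrite ddegU Q_rational mulr1 leNgt m0.
Qed.

Lemma RR_one_pred m f : L m f -> f <> 0 -> Q f <> - m -> L (m - 1) f.
Proof.
move=> /RR_oneP[f0 fm] /eqP fN Qf; apply/RR_oneP; split=> //; move: fm Qf.
rewrite !ord_geP //; lia.
Qed.

Lemma weierstrassP m : weierstrass Q m <-> exists f, [/\ L m f, f != 0 & Q f = - m].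
Proof.
split=> [[f [[r _ rf] /= f0] <-]|[f [mf f0 Qf]]].
  exists f; split; [|exact/eqP|by rewrite opprK].
  have [rf0 _] := (RR_oneP _ _).1 rf; apply/RR_oneP; split=> //.
  by right; rewrite opprK.
exists f; last by rewrite Qf opprK.
split; last exact/eqP.
by exists `|m|%N => //; apply: RR_one_le mf; lia.
Qed.

Lemma weierstrass_ge0 m : weierstrass Q m -> 0 <= m.
Proof.
move=> /weierstrassP[f [mf f0 _]]; rewrite leNgt; apply/negP=> m0.
by rewrite (RR_one_lt0 m0 mf) eqxx in f0.
Qed.

Lemma weierstrassD m m' :
  weierstrass Q m -> weierstrass Q m' -> weierstrass Q (m + m').
Proof.
move=> /weierstrassP[f [mf f0 Qf]] /weierstrassP[h [mh h0 Qh]]; apply/weierstrassP.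
exists (f * h); split; first by rewrite -freegUD; exact: RRM.
  exact: mulf_neq0.
by rewrite ordM // Qf Qh opprD.
Qed.

Lemma weierstrass0 : weierstrass Q 0.
Proof.
apply/weierstrassP; exists 1; split; rewrite ?oner_neq0 ?ord_one ?oppr0 //.
by apply/RR_oneP; split=> [P' _|]; right; rewrite ord_one.
Qed.

Lemma not_weierstrass_RR m : ~ weierstrass Q m -> L m `<=` L (m - 1).
Proof.
move=> Hm f mf; have [->|f0] := eqVneq f 0.
  by have [] := subspace_RR << (m - 1) *g Q >>.
apply: RR_one_pred => //; first exact/eqP.
by move=> Qf; apply: Hm; apply/weierstrassP; exists f.
Qed.

Lemma ell_one_step m : ell << m *g Q >> =
  (ell << (m - 1)%R *g Q >> + `[< weierstrass Q m >])%N.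
Proof.
apply/eqP; rewrite eqn_leq; apply/andP; split; case: asboolP => Hm.
- by have := ell_oneS genus_X Q_rational (m - 1); rewrite subrK addn1.
- rewrite addn0; apply/(has_free_ell genus_X Q_rational).
  apply: has_free_sub (not_weierstrass_RR Hm) _.
  exact/(has_free_ell genus_X Q_rational).
- have [f [mf f0 Qf]] := (weierstrassP m).1 Hm; rewrite addn1.
  apply/(has_free_ell genus_X Q_rational).
  apply: (has_freeS (subspace_RR << (m - 1) *g Q >>) _ mf) => [|/RR_oneP[_]|].
  + by apply: RR_one_le; lia.
  + rewrite ord_geP // Qf; lia.
  + exact/(has_free_ell genus_X Q_rational).
- rewrite addn0; apply/(has_free_ell genus_X Q_rational).
  have sub : L (m - 1) `<=` L m by apply: RR_one_le; lia.
  by apply: has_free_sub sub _; apply/(has_free_ell genus_X Q_rational).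
Qed.

(** A boolean predicate on [nat], the form in which the semigroup lemmas take H; [in_star] below
    does the same for H^*. *)
Definition in_semigroup (a : nat) : bool := `[< weierstrass Q a%:Z >].

Lemma ell_count c : ell << (c%:Z - 1) *g Q >> = (\sum_(0 <= i < c) in_semigroup i)%N.
Proof.
elim: c => [|c IH].
  rewrite big_geq //; apply/eqP; rewrite -leqn0 leqNgt; apply/negP.
  move=> /(ell_gt0 genus_X Q_rational) [f f0 /RR_one_lt0 fe].
  by rewrite fe ?eqxx in f0.
by rewrite big_nat_recr //= -IH -ell_one_step; congr (ell << _ *g Q >>); lia.
Qed.

(** For large c, the c - gaps c elements of H below c are counted by ell((c - 1)Q) = c - g. *)
Lemma gaps_large_eq : exists c0, forall c, (c0 <= c)%N -> gaps in_semigroup c = g.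
Proof.
have [m0 Hm] := ell_large genus_X Q_rational.
exists (`|m0|.+1)%N => c mc.
have : (gaps in_semigroup c + \sum_(0 <= i < c) in_semigroup i)%N = c.
  rewrite -big_split /= -[RHS]subn0; apply: sum_eq1 => i _; by case: (in_semigroup i).
rewrite -ell_count; have /Hm : m0 <= c%:Z - 1 by lia.
move: (ell _) (gaps _ _) => e d; lia.
Qed.

(** * The codes and the set H^* *)

Hypothesis P_rational : forall i : 'I_n, rational (P i).
Hypothesis P_neq_Q : forall i : 'I_n, P i <> Q.
Local Notation ev := (ev P).
Local Notation C := (code P Q).

Lemma RR_regular m f i : L m f -> ord_ge (P i) f 0.
Proof. by move=> /RR_oneP[f0 _]; exact: f0. Qed.

Lemma evD m f h : L m f -> L m h -> ev (f + h) = ev f + ev h.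
Proof.
by move=> mf mh; apply/rowP=> i; rewrite !mxE evalD //; exact: RR_regular.
Qed.

Lemma ev_mul m m' f h i : L m f -> L m' h -> ev (f * h) 0 i = ev f 0 i * ev h 0 i.
Proof. by move=> mf mh; rewrite !mxE evalM //; exact: RR_regular. Qed.

Lemma evZ m c f : L m f -> ev (cst c * f) = c *: ev f.
Proof.
move=> mf; apply/rowP=> i; rewrite !mxE evalM ?eval_cst //; last exact: RR_regular.
exact: ord_ge_cst.
Qed.

Lemma evB m f h : L m f -> L m h -> ev (f - h) = ev f - ev h.
Proof.
move=> mf mh; have [_ _ SZ] := subspace_RR << m *g Q >>.
have -> : f - h = f + cst (- 1) * h by rewrite rmorphN1 mulN1r.
by rewrite (evD mf (SZ _ _ mh)) (evZ _ mh) scaleN1r.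
Qed.

Lemma code_le m m' : m <= m' -> C m `<=` C m'.
Proof. by move=> mm _ [f mf <-]; exists f => //; exact: RR_one_le mf. Qed.

Lemma codeD m v w : C m v -> C m w -> C m (v + w).
Proof.
move=> [f mf <-] [h mh <-]; exists (f + h); last exact: evD mf mh.
by have [_ SD _] := subspace_RR << m *g Q >>; exact: SD.
Qed.

Lemma codeZ m c w : C m w -> C m (c *: w).
Proof.
move=> [f mf <-]; exists (cst c * f); last exact: evZ mf.
by have [_ _ SZ] := subspace_RR << m *g Q >>; exact: SZ.
Qed.

Lemma code0 m : C m 0.
Proof.
exists 0; first by have [] := subspace_RR << m *g Q >>.
by apply/rowP=> i; rewrite !mxE -(rmorph0 cst) eval_cst.
Qed.

(** The code as a vector space, generated by the finite list of its own words, so that dimensions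
    are available. *)
Definition codeV m : {vspace 'rV[k]_n} :=
  <<[seq w <- enum 'rV[k]_n | `[< C m w >]]>>%VS.

Lemma mem_codeV m w : reflect (C m w) (w \in codeV m).
Proof.
apply: (iffP idP) => [|mw]; last first.
  by apply: memv_span; rewrite mem_filter mem_enum andbT; apply/asboolP.
move=> wV; have -> := coord_span (X := in_tuple _) wV; elim/big_rec: _ => [|i v _].
  exact: code0.
apply: codeD; apply: codeZ.
have : [seq w <- enum 'rV[k]_n | `[< C m w >]]`_i \in
  [seq w <- enum 'rV[k]_n | `[< C m w >]] by apply: mem_nth.
by rewrite mem_filter => /andP[/asboolP].
Qed.

Lemma codeV_le m m' : m <= m' -> (codeV m <= codeV m')%VS.
Proof. by move=> mm; apply/subvP=> w /mem_codeV mw; apply/mem_codeV/(code_le mm). Qed.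

Lemma code_not_weierstrass m : ~ weierstrass Q m -> C m = C (m - 1).
Proof.
move=> Hm; apply/seteqP; split; last by apply: code_le; lia.
by move=> _ [f mf <-]; exists f => //; exact: not_weierstrass_RR.
Qed.

(** The constant is the value at Q of u / f, which is regular there; subtracting that multiple of f
    lowers the pole order. *)
Lemma RR_lead m f u : L m f -> f != 0 -> Q f = - m -> L m u ->
  exists c u', [/\ L (m - 1) u' & u = cst c * f + u'].
Proof.
move=> mf f0 Qf mu.
have uf : ord_ge Q (u / f) 0.
  have [_ Qu] := (RR_oneP _ _).1 mu.
  have : ord_ge Q f^-1 m by right; rewrite ordV // Qf opprK.
  by move=> /(ord_geM Qu); rewrite addNr.
have := evalP Q_rational uf; set c := eval _ _ => ufc.
exists c, (u - cst c * f); split; last by rewrite addrC subrK.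
apply/RR_oneP; split=> [P' P'Q|].
  have [_ _ SZ] := subspace_RR << m *g Q >>.
  by have /RR_oneP[+ _] := subspaceB (subspace_RR _) mu (SZ c _ mf); apply.
have -> : u - cst c * f = (u / f - cst c) * f by rewrite mulrBl divfK.
have -> : - (m - 1) = 1 + - m by rewrite opprB.
by apply: ord_geM => //; right; rewrite Qf.
Qed.

Lemma code_step m f : L m f -> f != 0 -> Q f = - m ->
  codeV m = (codeV (m - 1) + <[ev f]>)%VS.
Proof.
move=> mf f0 Qf; apply/vspaceP=> w; apply/mem_codeV/memv_addP.
  move=> [u mu <-]; have [c [u' [mu' ->]]] := RR_lead mf f0 Qf mu.
  have mu'' : L m u' by apply: RR_one_le mu'; lia.
  have [_ _ SZ] := subspace_RR << m *g Q >>.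
  exists (ev u'); first by apply/mem_codeV; exists u'.
  exists (c *: ev f); first by rewrite memvZ ?memv_line.
  by rewrite (evD (SZ c _ mf) mu'') (evZ _ mf) addrC.
move=> [v /mem_codeV mv [_ /vlineP[c ->] ->]]; apply: codeD.
  by apply: code_le mv; lia.
by apply: codeZ; exists f.
Qed.

Lemma code_eq_pred m f : L m f -> f != 0 -> Q f = - m ->
  C m = C (m - 1) <-> C (m - 1) (ev f).
Proof.
move=> mf f0 Qf; split=> [<-|fm]; first by exists f.
apply/seteqP; split; last by apply: code_le; lia.
move=> w /mem_codeV; rewrite (code_step mf f0 Qf) => /memv_addP[v /mem_codeV mv].
by move=> [_ /vlineP[c ->] ->]; apply: codeD => //; exact: codeZ.
Qed.

Definition in_star (a : nat) : bool := `[< Hstar P Q a%:Z >].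

Lemma Hstar_weierstrass m : Hstar P Q m -> weierstrass Q m.
Proof. by move=> [_ Cm]; apply: contrapT => /code_not_weierstrass. Qed.

Lemma dim_code_step m : 0 <= m ->
  \dim (codeV m) = (\dim (codeV (m - 1)) + `[< Hstar P Q m >])%N.
Proof.
move=> m0; have eqC : C m = C (m - 1) -> codeV m = codeV (m - 1).
  by move=> e; apply/vspaceP=> w; apply/mem_codeV/mem_codeV; rewrite e.
case: asboolP => [Hm|nHm]; last first.
  rewrite addn0 eqC //; apply: contrapT => Cm; exact: nHm.
have [f [mf f0 Qf]] := (weierstrassP m).1 (Hstar_weierstrass Hm).
apply/eqP; rewrite addn1 eqn_leq; apply/andP; split.
  rewrite (code_step mf f0 Qf) (leq_trans (dimv_add_leqif _ _)) //.
  rewrite -[X in (_ <= X)%N]addn1 leq_add2l.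
  by rewrite dim_vline leq_b1.
have sub : (codeV (m - 1) <= codeV m)%VS by apply: codeV_le; lia.
rewrite ltn_neqAle dimvS // andbT; apply/negP => /eqP e.
case: Hm => _; apply; apply/(code_eq_pred mf f0 Qf)/mem_codeV.
have /eqP -> : codeV (m - 1) == codeV m by rewrite eqEdim sub e leqnn.
by apply/mem_codeV; exists f.
Qed.

Lemma dim_code_lt0 m : m < 0 -> \dim (codeV m) = 0%N.
Proof.
move=> m0; apply/eqP; rewrite dimv_eq0; apply/eqP/vspaceP=> w; rewrite memv0.
apply/mem_codeV/eqP => [[f /(RR_one_lt0 m0) -> <-]|->]; last exact: code0.
by apply/rowP=> i; rewrite !mxE -(rmorph0 cst) eval_cst.
Qed.

Lemma dim_code_count c : \dim (codeV (c%:Z - 1)) = (\sum_(0 <= i < c) in_star i)%N.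
Proof.
elim: c => [|c IH]; first by rewrite big_geq // dim_code_lt0.
have -> : c.+1%:Z - 1 = c by lia.
by rewrite big_nat_recr //= -IH -dim_code_step.
Qed.

Lemma star_card_le c : (\sum_(0 <= i < c) in_star i <= n)%N.
Proof.
by rewrite -dim_code_count (leq_trans (dimvS (subvf _))) // dimvf /dim /= mul1n.
Qed.

Lemma in_star_semigroup a : in_star a -> in_semigroup a.
Proof. by move=> /asboolP/Hstar_weierstrass Ha; apply/asboolP. Qed.

(** If f of pole order a had the same evaluation as some u in L((a - 1)Q), then f h would have that
    of u h, which lies in L((a + b - 1)Q), and a + b would not be in H^*. *)
Lemma in_star_ideal a b :
  in_semigroup a -> in_semigroup b -> in_star (a + b) -> in_star a.
Proof.
move=> /asboolP/weierstrassP[f [af f0 Qf]] /asboolP/weierstrassP[h [bh h0 Qh]].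
move=> /asboolP[_ Cab]; apply/asboolP; split=> // /(code_eq_pred af f0 Qf) [u au eu].
apply: Cab; rewrite PoszD.
apply/(code_eq_pred (f := f * h)); rewrite ?mulf_neq0 ?ordM ?Qf ?Qh ?opprD //.
  by rewrite -freegUD; exact: RRM.
exists (u * h); first by rewrite addrAC -freegUD; exact: RRM.
by apply/rowP=> i; rewrite (ev_mul _ au bh) (ev_mul _ af bh) eu.
Qed.

Hypothesis P_inj : injective P.

(** Otherwise some nonzero f - u in L(aQ) vanishes at all n points, hence lies in a space L of a
    divisor of degree a - n < 0. *)
Lemma in_star_small a : in_semigroup a -> (a < n)%N -> in_star a.
Proof.
move=> /asboolP/weierstrassP[f [af f0 Qf]] an; apply/asboolP; split=> //.
move=> /(code_eq_pred af f0 Qf) [u au eu].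
have au' : L a%:Z u by apply: RR_one_le au; lia.
have fu0 : f - u != 0.
  rewrite subr_eq0; apply: contraPneq au => <- /RR_oneP[_].
  rewrite ord_geP // Qf; lia.
have afu := subspaceB (subspace_RR _) af au'.
pose s := [seq P i | i <- enum 'I_n].
have us : uniq s by rewrite map_inj_uniq ?enum_uniq.
have ds : ddeg (sumP s) = n%:Z.
  by rewrite ddeg_sumP => [|_ /mapP[i _ ->] //]; rewrite size_map size_enum_ord.
suff /(ddeg_ge0 genus_X Q_rational fu0) :
    RR ((<< a%:Z *g Q >> : divisor X) - sumP s) (f - u).
  by rewrite ddegB ddegU Q_rational ds; lia.
move=> P'; rewrite coeffB coeff_sumP count_uniq_mem //.
case: (boolP (P' \in s)) => [/mapP[i _ ->]|_]; last by rewrite subr0; exact: afu.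
have /negPf QP : Q != P i by apply/eqP => /esym/P_neq_Q.
rewrite coeffU QP mulr0 sub0r opprK; apply: eval_eq0 (RR_regular _ afu) _ => //.
have := evB af au'; rewrite eu subrr => /(congr1 (fun w : 'rV_n => w 0 i)).
by rewrite !mxE.
Qed.

(** * Ranks of the codes under the isometry-dual condition *)

Hypothesis n_large : (g.*2.+2 < n)%N.
Hypothesis isodual : isometry_dual (fun i : nat => code P Q (hstar P Q i)).
Local Notation H := in_semigroup.
Local Notation Hs := in_star.
Local Notation M := (n + g.*2 - 1)%N.

Let H0 : H 0.
Proof. exact/asboolP/weierstrass0. Qed.

Let HD a b : H a -> H b -> H (a + b).
Proof.
move=> /asboolP Ha /asboolP Hb; apply/asboolP.
by rewrite PoszD; exact: weierstrassD.
Qed.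

Let gapsL : exists c0, forall c, (c0 <= c)%N -> gaps H c = g.
Proof. exact: gaps_large_eq. Qed.

(** This is the dimension of C(D, (c - 1)Q). For a in H^*, [star_rank a.+1] is the index i with m_i
    = a. *)
Definition star_rank c := (\sum_(0 <= i < c) Hs i)%N.

Let rk_dim c : \dim (codeV (c%:Z - 1)) = star_rank c.
Proof. exact: dim_code_count. Qed.

Let rk_le c : (star_rank c <= n)%N.
Proof. exact: star_card_le. Qed.

Lemma star_rankS c : star_rank c.+1 = (star_rank c + Hs c)%N.
Proof. by rewrite /star_rank big_nat_recr. Qed.

Lemma leq_star_rank c d : (c <= d)%N -> (star_rank c <= star_rank d)%N.
Proof.
by move=> cd; rewrite /star_rank (big_cat_nat (n := c) (p := d)) //= leq_addr.
Qed.

Lemma star_rank_gaps c : (c <= n)%N -> (star_rank c + gaps H c)%N = c.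
Proof.
move=> cn; rewrite -big_split /= -[RHS]subn0; apply: sum_eq1 => i /andP[_ ic].
case: (boolP (H i)) => Hi; first by rewrite in_star_small // (leq_trans ic).
by rewrite (negPf (contra (@in_star_semigroup i) Hi)).
Qed.

(** Up to n, the rank of c is c - gaps c. For a <= b: if a + 1 >= 2g, the sum is a + b + 2 - 2g;
    otherwise the ranks are at most those of 2g and n, namely g and n - g. *)
Lemma star_rank_sum a b : (a < n)%N -> (b < n)%N -> (a + b < M)%N ->
  (star_rank a.+1 + star_rank b.+1 <= n)%N.
Proof.
wlog ab : a b / (a <= b)%N.
  move=> hw an bn; case: (leqP a b) => [/hw|/ltnW/hw]; first exact.
  by rewrite addnC [(star_rank _ + _)%N]addnC; apply.
move=> an bn abM; have ra := star_rank_gaps an; have rb := star_rank_gaps bn.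
have [a2|a2] := ltnP a.+1 g.*2.
  have := leq_star_rank (ltnW a2); have := leq_star_rank bn.
  have := star_rank_gaps (leqnn n); have : (g.*2 <= n)%N by lia.
  move=> g2n; have := star_rank_gaps g2n; rewrite !(gaps_conductor HD gapsL) //; lia.
have b2 : (g.*2 <= b.+1)%N by lia.
by move: ra rb; rewrite !(gaps_conductor HD gapsL) //; lia.
Qed.

Lemma dim_code_hstar i : (i <= n)%N -> \dim (codeV (hstar P Q i)) = i.
Proof.
move=> /(let: And3 _ lin _ := isodual in lin i) [V /= eV dV].
rewrite -[RHS]dV; congr (\dim _).
by apply/vspaceP=> w; apply/mem_codeV/idP; rewrite eV.
Qed.

Lemma code_eq_dim m m' : \dim (codeV m) = \dim (codeV m') -> C m = C m'.
Proof.
wlog mm : m m' / m <= m'.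
  by move=> hw; case: (leP m m') => [/hw//|/ltW/hw e /esym/e].
move=> e; have sub := codeV_le mm.
have /eqP ee : codeV m == codeV m' by rewrite eqEdim sub e leqnn.
by apply/seteqP; split=> w /mem_codeV wm; apply/mem_codeV; move: wm; rewrite ee.
Qed.

Lemma code_hstar c : C (hstar P Q (star_rank c)) = C (c%:Z - 1).
Proof. by apply: code_eq_dim; rewrite dim_code_hstar ?rk_le // rk_dim. Qed.

Lemma star_rank_total : exists c, star_rank c = n.
Proof.
exists (`|hstar P Q n|.+1); apply/eqP; rewrite eqn_leq rk_le -rk_dim.
rewrite -[X in (X <= _)%N](dim_code_hstar (leqnn n)) dimvS //.
apply: codeV_le => //; lia.
Qed.

(** * The functional defined by the isometry *)

Section Functional.
Variable x : 'rV[k]_n.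
Hypothesis x_dual : forall i, (i <= n)%N ->
  chi x @` C (hstar P Q i) = dual_code (C (hstar P Q (n - i)%N)).

(** With i = [star_rank a.+1], the word chi_x(ev f) is in the dual of C_{n-i}, and ev h is in
    C_{n-i} because the two ranks add up to at most n. *)
Lemma functional_mul a b (f h : F) : (star_rank a.+1 + star_rank b.+1 <= n)%N ->
  L a%:Z f -> L b%:Z h -> \sum_j x 0 j * ev (f * h) 0 j = 0.
Proof.
move=> abn af bh.
have ec c : c.+1%:Z - 1 = c :> int by lia.
have : dual_code (C (hstar P Q (n - star_rank a.+1)%N)) (chi x (ev f)).
  rewrite -x_dual ?rk_le //; exists (ev f) => //.
  by rewrite code_hstar ec; exists f.
have : C (hstar P Q (n - star_rank a.+1)%N) (ev h).
  have : C (hstar P Q (star_rank b.+1)) (ev h) by rewrite code_hstar ec; exists h.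
  move=> /mem_codeV hb; apply/mem_codeV; apply: subvP hb.
  have nb : (star_rank b.+1 <= n - star_rank a.+1)%N by lia.
  (* The codes form a chain: if the pole orders come in the unexpected order, comparing dimensions
     forces the two codes to be equal. *)
  have [le|le] := leP (hstar P Q (star_rank b.+1)) (hstar P Q (n - star_rank a.+1)%N).
    exact: codeV_le.
  have sub := codeV_le (ltW le).
  suff /eqP -> : codeV (hstar P Q (n - star_rank a.+1)%N) ==
    codeV (hstar P Q (star_rank b.+1)) by [].
  by rewrite eqEdim sub !dim_code_hstar ?rk_le ?leq_subr.
move=> Ch /(_ _ Ch) e; rewrite -[RHS]e; apply: eq_bigr => j _.
rewrite (ev_mul _ af bh) !mxE; ring.
Qed.

(** By induction on the pole order. A gap c adds no function; for c in H, a function in L(cQ) is a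
    multiple of a product f h, killed by [functional_mul], plus a function in L((c - 1)Q). *)
Lemma functional_eq0 c w : (c <= M)%N -> C (c%:Z - 1) w -> \sum_j x 0 j * w 0 j = 0.
Proof.
elim: c w => [|c IH] w cM Cw.
  suff -> : w = 0 by rewrite big1 // => j _; rewrite mxE mulr0.
  apply/eqP; rewrite -memv0; have /eqP <- : codeV (0%N%:Z - 1) == 0%VS.
    by rewrite -dimv_eq0 rk_dim /star_rank big_geq.
  exact/mem_codeV.
have ec : c.+1%:Z - 1 = c :> int by lia.
move: Cw; rewrite ec; have [Hc|nHc] := boolP (H c); last first.
  rewrite (code_not_weierstrass (m := c)) => [|/asboolP Hc]; last by case/negP: nHc.
  by apply: IH; exact: ltnW.
have [|a [b [Ha Hb abc [an bn]]]] := semigroup_sum HD gapsL H0 n_large Hc; first by lia.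
have [f [af f0 Qf]] := (weierstrassP _).1 (asboolP _ Ha).
have [h [bh h0 Qh]] := (weierstrassP _).1 (asboolP _ Hb).
have cfh : L c%:Z (f * h) by rewrite -abc PoszD -freegUD; exact: RRM.
have Qfh : Q (f * h) = - c%:Z by rewrite ordM // Qf Qh -opprD -PoszD abc.
move=> [u cu <-].
have [e [u' [cu' ->]]] := RR_lead cfh (mulf_neq0 f0 h0) Qfh cu.
have cu'' : L c%:Z u' by apply: RR_one_le cu'; lia.
have [_ _ SZ] := subspace_RR << c%:Z *g Q >>.
rewrite (evD (SZ e _ cfh) cu'').
rewrite (evZ _ cfh).
have ex j : x 0 j * (e *: ev (f * h) + ev u') 0 j =
    e * (x 0 j * ev (f * h) 0 j) + x 0 j * ev u' 0 j.
  by rewrite mxE [X in X + _]mxE mulrDr mulrCA.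
rewrite (eq_bigr _ (fun j _ => ex j)).
rewrite big_split -big_distrr /= (functional_mul _ af bh) ?mulr0 ?add0r.
  by apply: IH; [exact: ltnW|exists u'].
by apply: star_rank_sum => //; lia.
Qed.

End Functional.

Lemma star_rank_ge c : (n + g.*2 <= c)%N -> star_rank c = star_rank (n + g.*2).
Proof.
move=> ngc; rewrite /star_rank (big_cat_nat (n := (n + g.*2)%N) (p := c)) //=.
suff -> : (\sum_(n + g.*2 <= i < c) Hs i = 0)%N by rewrite addn0.
rewrite big_nat_cond big1 // => i; rewrite andbT => /andP[ni _].
case: (boolP (Hs i)) => // /(star_le gapsL in_star_ideal rk_le).
by rewrite ltnNge ni.
Qed.

Lemma star_rank_max : star_rank (n + g.*2) = n.
Proof.
have [c rc] := star_rank_total; apply/eqP; rewrite eqn_leq rk_le /=.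
rewrite -(star_rank_ge (leq_maxr c (n + g.*2))) -[X in (X <= _)%N]rc.
by rewrite leq_star_rank // leq_maxl.
Qed.

(** Otherwise C(D, (M - 1)Q) has dimension n and contains the first unit vector, at which the
    functional takes a nonzero coordinate of x instead of 0. *)
Lemma in_star_max : Hs M.
Proof.
apply: contraT => nHs; have [_ _ [x x0 xd]] := isodual.
have eM : (n + g.*2)%N = M.+1 by lia.
have rM : star_rank M = n.
  by have := star_rank_max; rewrite {1}eM star_rankS (negPf nHs) addn0.
have full w : C (M%:Z - 1) w.
  apply/mem_codeV; suff /eqP -> : codeV (M%:Z - 1) == fullv by exact: memvf.
  by rewrite eqEdim subvf /= rk_dim rM dimvf /dim /= mul1n.
have n0 : (0 < n)%N by lia.
have := functional_eq0 xd (leqnn M) (full (delta_mx 0 (Ordinal n0))).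
rewrite (bigD1 (Ordinal n0)) //= big1 ?addr0 => [|j jn].
  by rewrite mxE !eqxx mulr1 => /eqP; rewrite (negPf (x0 _)).
by rewrite mxE (negPf jn) andbF mulr0.
Qed.

(** * Symmetry of H^* and equality of the two bounds *)

Let Hs_sym a : Hs a -> Hs (M - a)%N.
Proof.
exact: (star_sym HD gapsL in_star_ideal rk_le in_star_semigroup n_large
  in_star_small in_star_max star_rank_max).
Qed.

Let Hs_lt a : Hs a -> (a < n + g.*2)%N.
Proof. exact: (star_le gapsL in_star_ideal rk_le). Qed.

Lemma Hstar_natP z : Hstar P Q z <-> exists a : nat, z = a%:Z /\ Hs a.
Proof.
split=> [Hz|[a [-> /asboolP]]//]; case: (Hz) => z0 _.
by exists `|z|%N; rewrite gez0_abs //; split=> //; apply/asboolP; rewrite gez0_abs.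
Qed.

Lemma weierstrass_natP z : weierstrass Q z <-> exists a : nat, z = a%:Z /\ H a.
Proof.
split=> [Hz|[a [-> /asboolP]]//].
have z0 := weierstrass_ge0 Hz.
by exists `|z|%N; rewrite gez0_abs //; split=> //; apply/asboolP; rewrite gez0_abs.
Qed.

Lemma Hstar_finite : finite_set (Hstar P Q).
Proof.
rewrite (@set_natE (Hstar P Q) Hs (n + g.*2)) // => z; rewrite Hstar_natP.
split=> [[a [-> Ha]]|[a [-> _ Ha]]]; exists a; split=> //; exact: Hs_lt.
Qed.

Lemma card_Hstar (a : nat) : card [set h | Hstar P Q h /\ h <= a%:Z] = star_rank a.+1.
Proof.
apply: card_nat => z; split=> [[/Hstar_natP[b [-> Hb]] ba]|[b [-> ba Hb]]].
  by exists b; split=> //; lia.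
by split; [apply/Hstar_natP; exists b|lia].
Qed.

Lemma hstarP i : (1 <= i <= n)%N ->
  exists a : nat, [/\ hstar P Q i = a%:Z, Hs a & star_rank a.+1 = i].
Proof.
move=> /andP[i1 iN].
have exc : exists c, (i <= star_rank c)%N by exists (n + g.*2)%N; rewrite star_rank_max.
(* If c + 1 is least with rank at least i, then c is in H^* and has index i. Hence the set that
   defines [hstar] is inhabited and the default 0 of [xget] is not taken. *)
case: (ex_minnP exc) => -[|c]; first by rewrite /star_rank big_geq // leqNgt i1.
move=> ic cmin.
have ric : (star_rank c < i)%N by rewrite ltnNge; apply/negP => /cmin; rewrite ltnn.
have [Hc rc] : Hs c /\ star_rank c.+1 = i.
  by move: ic; rewrite star_rankS; case: (Hs c); lia.
rewrite /hstar eqn0Ngt i1 /=.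
case: xgetP => [z _ [/Hstar_natP[a [-> Ha]]]|/(_ c%:Z) []].
  by rewrite card_Hstar; exists a.
by split; [apply/Hstar_natP; exists c|rewrite card_Hstar].
Qed.

Lemma star_rank_leE a b : Hs a -> Hs b ->
  (star_rank a.+1 <= star_rank b.+1)%N = (a <= b)%N.
Proof.
move=> Ha Hb; have [ab|ba] := leqP a b; first by rewrite leq_star_rank.
by apply/negbTE; rewrite -ltnNge (star_rankS a) Ha addn1 ltnS leq_star_rank.
Qed.

Lemma hstar_star_rank a : Hs a -> hstar P Q (star_rank a.+1) = a%:Z.
Proof.
move=> Ha; have [|b [-> Hb e]] := @hstarP (star_rank a.+1).
  by rewrite rk_le star_rankS Ha addn1.
congr Posz; apply/eqP; rewrite eqn_leq -(star_rank_leE Hb Ha).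
by rewrite -(star_rank_leE Ha Hb) e leqnn.
Qed.

(** The bijection is t |-> a + t. If t1 + t2 = M - a, which is in H^* by symmetry, then t2 is in H^*
    by the ideal property, and so is a + t1 = M - t2. Conversely, if m = a + m2 is in H^*, so is M -
    m = (M - a) - m2. *)
Lemma card_Aset (r a : nat) : Hs a -> hstar P Q r = a%:Z ->
  card (Aset Q (M - a)%N%:Z) = card (Lambda_star P Q r).
Proof.
move=> Ha ra; have aM := Hs_lt Ha.
have Lf : finite_set (Lambda_star P Q r).
  by apply: sub_finite_set Hstar_finite => z [].
rewrite -(card_injective_image (f := fun z => z - a%:Z) _ Lf); last exact: addIr.
congr card; apply/seteqP; split=> [t [/weierstrass_natP[t1 [-> H1]]]|].
  move=> /weierstrass_natP[t2 [e H2]].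
  have e' : (t1 + t2)%N = (M - a)%N by lia.
  have Ht : Hs (t1 + t2)%N by rewrite e'; exact: Hs_sym.
  have Ht1 := in_star_ideal H1 H2 Ht.
  have Ht2 : Hs t2 by apply: (in_star_ideal H2 H1); rewrite addnC.
  exists (a + t1)%N%:Z; last by rewrite PoszD addrC addKr.
  split; last by exists t1%:Z; [apply/Hstar_natP; exists t1|rewrite ra PoszD].
  apply/Hstar_natP; exists (a + t1)%N; split=> //.
  have -> : (a + t1)%N = (M - t2)%N by lia.
  exact: Hs_sym.
move=> t [z [/Hstar_natP[m [-> Hm]] [z2 /Hstar_natP[m2 [-> Hm2]]]]].
rewrite ra => e <-.
have mM := Hs_lt Hm.
split; apply/weierstrass_natP; first by exists m2; split; [lia|exact: in_star_semigroup].
by exists (M - m)%N; split; [lia|apply/in_star_semigroup/Hs_sym].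
Qed.

(** Both minima range over the same cardinals: h corresponds to the index r of M - h, and h >= M -
    m_i means r <= i. *)
Lemma d_ORD_ev_d_star i : (1 <= i <= n)%N -> d_ORD_ev P Q g i = d_star P Q i.
Proof.
move=> iN; rewrite /d_ORD_ev /d_star; congr minimum.
have [a [ea Ha ra]] := hstarP iN; have aM := Hs_lt Ha.
apply/seteqP; split=> t /= [].
  move=> h [/Hstar_natP[b [-> Hb]]]; rewrite ea => hb <-.
  have bM := Hs_lt Hb; have Hb' := Hs_sym Hb.
  exists (star_rank (M - b).+1); last first.
    by rewrite -(card_Aset Hb' (hstar_star_rank Hb')) subKn //; lia.
  rewrite {1}star_rankS Hb' addn1 /= -ra star_rank_leE //; lia.
move=> r /andP[r1 ri] <-.
have [|b [eb Hb rb]] := @hstarP r; first by lia.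
exists (M - b)%N%:Z; last exact: card_Aset.
split; first by apply/Hstar_natP; exists (M - b)%N; split=> //; exact: Hs_sym.
have : (b <= a)%N by rewrite -star_rank_leE // ra rb.
have := Hs_lt Hb; rewrite ea; lia.
Qed.

End OnePoint.

Theorem corollary4p12 (k : finFieldType) (X : curve k) (g n : nat)
    (P : 'I_n -> point X) (Q : point X)
    (genus_X : has_genus X g)
    (Q_rational : rational Q)
    (P_rational : forall i : 'I_n, rational (P i))
    (P_inj : injective P)
    (P_neq_Q : forall i : 'I_n, P i <> Q)
    (n_large : (2 * g + 2 < n)%N)
    (isodual : isometry_dual (fun i : nat => code P Q (hstar P Q i))) :
  forall i : nat, (1 <= i <= n)%N -> d_ORD_ev P Q g i = d_star P Q i.
Proof.
by apply: d_ORD_ev_d_star => //; move: n_large; rewrite mul2n addn2.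
Qed.
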